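(* Let $\Gamma\in\mathcal S$ have $n$ vertices and let $\varphi$ be an embedding into $\mathbb Z^n$ such that exactly one index is of type (9), exactly one is of type (5), exactly one is of type (2), and every other index is of type (4) or (7). Then $\Gamma\in\mathcal C$.
   Context: A plumbing tree is a finite tree $\Gamma$ each of whose vertices $v$ carries an integer decoration $d(v)$. $\Gamma$ is minimal if no vertex has decoration $-1$. For $n\ge 1$ let $(\mathbb Z^n,Q_n)$ be the lattice with basis $E_1,\dots,E_n$ and $Q_n(E_i,E_j)=-\delta_{ij}$, and let $K=\sum_{i=1}^n E_i$. A plumbing tree $\Gamma$ on $n$ vertices is a symplectic plumbing tree if there is a map $\varphi$ (an embedding) from its vertex set to $\mathbb Z^n$ such that: for distinct vertices $v_1,v_2$, $Q_n(\varphi(v_1),\varphi(v_2))$ is $1$ if they are adjacent and $0$ otherwise; $Q_n(\varphi(v),\varphi(v))=d(v)$ for every $v$; and $Q_n(\varphi(v),K)+Q_n(\varphi(v),\varphi(v))=-2$ for every $v$. $\mathcal S$ is the set of minimal, connected symplectic plumbing trees. Index types: write $\varphi(v)=\sum_i a_{v,i}E_i$; for an index $i$ consider the multiset of nonzero coefficients $a_{v,i}$ as $v$ ranges over all vertices. Index $i$ is of type (1) if this multiset is $\{1\}$, (2) if $\{-1\}$, (3) if $\{-2\}$, (4) if $\{1,-1\}$, (5) if $\{1,-2\}$, (6) if $\{-1,-1\}$, (7) if $\{1,-1,-1\}$, (9) if $\{1,-1,-1,-1\}$, and (10) if it is empty. If $u$ is a vertex of decoration $-1$, blowing up $u$ means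 adding a new vertex of decoration $-1$ adjacent only to $u$ and decreasing $d(u)$ by $1$; blowing up an edge $uw$ means deleting that edge, adding a new vertex of decoration $-1$ adjacent exactly to $u$ and $w$, and decreasing $d(u)$ and $d(w)$ by $1$. Let $T_c$ be the tree with a central vertex of decoration $-1$ and three leaves of decorations $-2,-6,-3$. $\mathcal C$ is the set of trees obtained from $T_c$ by a finite (possibly empty) sequence of blow-ups, each of which blows up the current unique $(-1)$-vertex or an edge emanating from it, followed by changing the decoration of the unique $(-1)$-vertex to $-2$. *)

(* Defs.v *)
From mathcomp Require Import all_boot all_order all_algebra.
Set Implicit Arguments. Unset Strict Implicit. Unset Printing Implicit Defensive.
Import Order.TTheory GRing.Theory Num.Theory.
Local Open Scope ring_scope.

Definition is_tree (n : nat) (adj : rel 'I_n) : Prop :=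
  [/\ (0 < n)%N,
      (forall x y, adj x y = adj y x),
      (forall x, ~~ adj x x),
      (forall x y, connect adj x y) &
      #|[set p : 'I_n * 'I_n | adj p.1 p.2 && (p.1 < p.2)%N]| = n.-1].

Definition connected_graph (n : nat) (adj : rel 'I_n) : Prop :=
  forall x y, connect adj x y.

Definition minimal_dec (n : nat) (d : 'I_n -> int) : Prop :=
  forall v, d v != -1.

Definition Qn (n : nat) (x y : 'I_n -> int) : int :=
  - \sum_(i < n) x i * y i.

Definition Kn (n : nat) : 'I_n -> int := fun _ => 1.

(* phi v = \sum_i a v i E_i, i.e. phi v is the coefficient vector a v. *)
Definition is_embedding (n : nat) (adj : rel 'I_n) (d : 'I_n -> int)
  (phi : 'I_n -> 'I_n -> int) : Prop :=
  [/\ (forall v1 v2, v1 != v2 ->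
         Qn (phi v1) (phi v2) = (if adj v1 v2 then 1 else 0)),
      (forall v, Qn (phi v) (phi v) = d v) &
      (forall v, Qn (phi v) (@Kn n) + Qn (phi v) (phi v) = -2)].

Definition symplectic (n : nat) (adj : rel 'I_n) (d : 'I_n -> int) : Prop :=
  exists phi, is_embedding adj d phi.

Definition in_S (n : nat) (adj : rel 'I_n) (d : 'I_n -> int) : Prop :=
  [/\ is_tree adj, minimal_dec d, connected_graph adj & symplectic adj d].

Definition coeffs_at (n : nat) (phi : 'I_n -> 'I_n -> int) (i : 'I_n) : seq int :=
  [seq phi v i | v <- enum 'I_n & phi v i != 0].

Definition type_multiset (k : nat) : option (seq int) :=
  match k with
  | 1%N => Some [:: 1]
  | 2%N => Some [:: -1]
  | 3%N => Some [:: -2]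
  | 4%N => Some [:: 1; -1]
  | 5%N => Some [:: 1; -2]
  | 6%N => Some [:: -1; -1]
  | 7%N => Some [:: 1; -1; -1]
  | 9%N => Some [:: 1; -1; -1; -1]
  | 10%N => Some [::]
  | _ => None
  end.

Definition index_type (n : nat) (phi : 'I_n -> 'I_n -> int) (i : 'I_n) (k : nat) : bool :=
  if type_multiset k is Some s then perm_eq (coeffs_at phi i) s else false.

(* Decorated graphs with vertices 0, ..., dn-1 (values outside are irrelevant). *)
Record dgraph := DGraph { dn : nat; dadj : nat -> nat -> bool; ddec : nat -> int }.

Definition Tc : dgraph :=
  DGraph 4
    (fun x y => ((x == 0%N) && (y \in [:: 1; 2; 3]%N)) ||
                ((y == 0%N) && (x \in [:: 1; 2; 3]%N)))
    (fun x => match x with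
              | 0%N => -1 | 1%N => -2 | 2%N => -6 | 3%N => -3 | _ => 0 end).

Definition blowup_vertex (T : dgraph) (u : nat) : dgraph :=
  let m := dn T in
  DGraph m.+1
    (fun x y => [|| dadj T x y, (x == u) && (y == m) | (x == m) && (y == u)])
    (fun x => if x == m then -1 else if x == u then ddec T x - 1 else ddec T x).

Definition blowup_edge (T : dgraph) (u w : nat) : dgraph :=
  let m := dn T in
  DGraph m.+1
    (fun x y => [|| dadj T x y && ~~ (((x == u) && (y == w)) || ((x == w) && (y == u))),
                   (x == u) && (y == m), (x == m) && (y == u),
                   (x == w) && (y == m) | (x == m) && (y == w)])
    (fun x => if x == m then -1
              else if (x == u) || (x == w) then ddec T x - 1 else ddec T x).

(* Creach T u : T is obtained from T_c by a finite sequence of blow-ups, each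
   blowing up the current unique (-1)-vertex or an edge emanating from it;
   u is the current unique (-1)-vertex. *)
Inductive Creach : dgraph -> nat -> Prop :=
| Creach_Tc : Creach Tc 0
| Creach_vertex T u : Creach T u -> ddec T u = -1 ->
    Creach (blowup_vertex T u) (dn T)
| Creach_edge T u w : Creach T u -> ddec T u = -1 -> (w < dn T)%N -> dadj T u w ->
    Creach (blowup_edge T u w) (dn T).

Definition set_dec (T : dgraph) (u : nat) (c : int) : dgraph :=
  DGraph (dn T) (dadj T) (fun x => if x == u then c else ddec T x).

Definition dg_iso (n : nat) (adj : rel 'I_n) (d : 'I_n -> int) (T : dgraph) : Prop :=
  dn T = n /\
  exists f : 'I_n -> 'I_n, [/\ injective f,
     (forall x y, adj x y = dadj T (f x) (f y)) &
     (forall x, d x = ddec T (f x))].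

Definition in_C (n : nat) (adj : rel 'I_n) (d : 'I_n -> int) : Prop :=
  exists T u, Creach T u /\ dg_iso adj d (set_dec T u (-2)).

(* Main.v *)
(* Blow down one (-1)-curve at a time. With the embedding fixed, a state is a pair
   (V, I) of surviving vertices and surviving indices, and blowing down a vertex
   whose class restricted to I is E_i just removes it from V and i from I; nonnegative
   intersections and connectedness survive. Deleting the type (2) index first gives
   |V| = |I| + 1, so the classes satisfy a linear relation, which can be taken with
   positive coefficients (Perron-Frobenius). Pairing it with K and using adjunction,
   some vertex has square -1, because the coefficient -2 rules out that all squares
   equal -2. If the index of that (-1)-vertex has type (4) or (7), it was created by
   blowing up a vertex or an edge, and minimality makes the (-1)-vertex left after
   contracting it an endpoint; type (5) would force an intersection number 2. If the
   index has type (9), three more contractions are forced and the tree is T_c. *)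
Require Import Defs.
From mathcomp Require Import all_boot all_order all_algebra.
From mathcomp Require Import zify ring.
Set Implicit Arguments. Unset Strict Implicit. Unset Printing Implicit Defensive.
Import Order.TTheory GRing.Theory Num.Theory.
Local Open Scope ring_scope.

(** * Connectedness of integer-weighted graphs, expressed by cuts *)

(** Stated by cuts rather than paths because each use needs an edge leaving a given set: growing a
    vertex set, leaving the zero set of a relation, or repairing connectedness after a
    contraction. *)
Definition cut_connected (T : finType) (W : T -> T -> int) (V : {set T}) :=
  forall S : {set T}, S \subset V -> S != set0 -> S != V ->
    exists x y, [/\ x \in S, y \in V :\: S & 0 < W x y].

Lemma connect_cut_connected (T : finType) (W : T -> T -> int) (e : rel T) :
  (forall x y, e x y -> 0 < W x y) -> (forall x y, connect e x y) ->
  cut_connected W setT.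
Proof.
move=> eW conn S _ /set0Pn [x0 x0S] SnT.
have [y0 y0S] : exists y, y \notin S.
  by apply/existsP; apply: contraNT SnT => /existsPn H; apply/eqP/setP=> y;
     rewrite inE; have := H y; rewrite negbK.
case/connectP: (conn x0 y0) => p; elim: p x0 x0S => [|z p IHp] x xS /=.
  by move=> _ y0E; rewrite y0E xS in y0S.
case/andP=> exz zp y0E; have [zS|zS] := boolP (z \in S); first exact: (IHp z).
by exists x, z; split; rewrite ?inE ?zS //; apply: eW.
Qed.

(* The right-hand side counts each edge twice; a spanning tree through the edge
   [x0 y0] has [#|V| - 2] further edges, each of weight at least 1. *)
Lemma cut_connected_weight (T : finType) (W : T -> T -> int) (V : {set T}) x0 y0 :
  (forall x y, W x y = W y x) ->
  {in V &, forall x y, x != y -> 0 <= W x y} -> cut_connected W V ->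
  x0 \in V -> y0 \in V -> x0 != y0 ->
  (2 * #|V|%:Z - 4) + 2 * W x0 y0 <= \sum_(x in V) \sum_(y in V | y != x) W x y.
Proof.
move=> Wsym W0 Wcut x0V y0V xy0.
pose wt (S : {set T}) := \sum_(x in S) \sum_(y in S | y != x) W x y.
(* The bound is an equality for [[set x0; y0]]; each vertex added across a cut then contributes at
   least 1 in each of the two orders. *)
suff grow k : forall S : {set T}, #|V :\: S| = k -> S \subset V -> S != set0 ->
    (2 * #|S|%:Z - 4) + 2 * W x0 y0 <= wt S ->
    (2 * #|V|%:Z - 4) + 2 * W x0 y0 <= wt V.
  apply: (grow _ [set x0; y0] erefl).
  - by apply/subsetP=> z; rewrite !inE => /orP [] /eqP ->.
  - by apply/set0Pn; exists x0; rewrite !inE eqxx.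
  rewrite cards2 xy0 /wt big_setU1 ?inE //= big_set1.
  rewrite (bigD1 y0) /=; last by rewrite !inE eqxx orbT eq_sym.
  rewrite [X in _ <= _ + X + _]big1; last first.
    by move=> z; rewrite !inE => /andP [/andP [/orP [->|/eqP ->]]] //; rewrite eqxx.
  rewrite (bigD1 x0) /=; last by rewrite !inE eqxx.
  rewrite big1; last first.
    by move=> z; rewrite !inE => /andP [/andP [/orP [/eqP ->|->]]] //; rewrite eqxx.
  rewrite (Wsym y0); lia.
elim: k => [|k IHk] S cVS sSV Sn0 wS.
  have -> : V = S; last by [].
  by apply/eqP; rewrite eqEsubset sSV andbT -setD_eq0 -cards_eq0 cVS.
have SnV : S != V by apply: contra_eqT cVS => /negPn/eqP->; rewrite setDv cards0.
have [x [y [xS yVS Wxy]]] := Wcut S sSV Sn0 SnV.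
have [yS yV] : y \notin S /\ y \in V by move: yVS; rewrite inE => /andP.
have cS' : #|V :\: (y |: S)| = k.
  have -> : V :\: (y |: S) = (V :\: S) :\ y by rewrite setDDl setUC.
  by apply/eqP; rewrite -(eqn_add2l (y \in V :\: S)) -cardsD1 yVS cVS.
apply: (IHk (y |: S)) => //.
- by apply/subsetP=> z; rewrite !inE => /orP [/eqP ->|/(subsetP sSV)].
- by apply/set0Pn; exists y; rewrite setU11.
have -> : wt (y |: S) = wt S + 2 * \sum_(z in S) W z y.
  rewrite /wt big_setU1 //=.
  have -> : \sum_(z in y |: S | z != y) W y z = \sum_(z in S) W z y.
    apply: eq_big => [z|z _]; last exact: Wsym.
    by rewrite !inE; case: eqP => [->|]; rewrite ?(negPf yS) ?andbT.
  have -> : \sum_(z in S) \sum_(t in y |: S | t != z) W z t =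
            \sum_(z in S) (W z y + \sum_(t in S | t != z) W z t).
    apply: eq_bigr => z zS; rewrite (bigD1 y) /=; last first.
      by rewrite setU11; apply: contraNneq yS => ->.
    congr (_ + _); apply: eq_bigl => t; rewrite !inE.
    by case: (t =P y) => [->|_]; rewrite ?(negPf yS) ?andbF ?andbT.
  rewrite big_split /=; ring.
have : 1 <= \sum_(z in S) W z y.
  rewrite (bigD1 x) //=.
  rewrite -[1]addr0 lerD -?gtz0_ge1 //.
  apply: sumr_ge0 => z /andP [zS _]; apply: W0 => //; first exact: (subsetP sSV).
  by apply: contraNneq yS => <-.
rewrite cardsU1 yS; move: wS.
by move: #|S| (wt S) (W x0 y0) (\sum_(z in S) _) => p q r s; clear; lia.
Qed.

(** No integer lies strictly between -1 and 0. Adjunction makes sums of such terms equal to 2. *)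
Lemma mul_succ_ge0 (z : int) : 0 <= z * (z + 1).
Proof. by nia. Qed.

Lemma mul_succ_eq0_le0 (z : int) : z * (z + 1) = 0 -> z <= 0.
Proof. by nia. Qed.

(** * Vertex numbers in blow-up sequences *)

(** Since [dadj] is defined on all of [nat], this bound is what makes [dn G] a genuinely new vertex
    at each blow-up. *)
Lemma Creach_lt G m : Creach G m ->
  (m < dn G)%N /\ forall x y, dadj G x y -> (x < dn G)%N /\ (y < dn G)%N.
Proof.
elim=> {G m} [|G u _ [um IH] _|G u w _ [um IH] _ wm uw].
- split=> // x y /=; rewrite !inE.
  by case/orP=> /andP [/eqP -> /or3P [] /eqP ->].
- split=> // x y /= /or3P.
  case=> [/IH [] /ltnW xm /ltnW ym|/andP [/eqP -> /eqP ->]|/andP [/eqP -> /eqP ->]];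
  by rewrite !ltnS ?leqnn ?(ltnW um).
split=> // x y /=.
case/orP=> [/andP [/IH [] /ltnW xm /ltnW ym _]|]; first by rewrite !ltnS.
by case/or4P=> /andP [/eqP -> /eqP ->]; rewrite !ltnS leqnn ?(ltnW um) ?(ltnW wm).
Qed.

Lemma Creach_fresh G m x : Creach G m ->
  (dadj G (dn G) x = false) * (dadj G x (dn G) = false).
Proof.
by move=> /Creach_lt [_ lt]; split; apply/negP=> /lt []; rewrite ltnn.
Qed.

(** * Configurations of classes and their linear relations *)

Section Configuration.

Variables (T J : finType) (a : T -> J -> int).
Implicit Types (V : {set T}) (I : {set J}) (u v w : T) (i j : J).

Definition pairing I v w : int := - \sum_(i in I) a v i * a w i.

(** The second clause lets sums over [V] at a surviving index run over all of [T], so index types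
    can be stated once for the full columns. *)
Definition config V I :=
  [/\ #|V| = #|I|.+1,
      (forall v i, i \in I -> v \notin V -> a v i = 0),
      {in V &, forall v w, v != w -> 0 <= pairing I v w} &
      cut_connected (pairing I) V].

Lemma pairing_sym I v w : pairing I v w = pairing I w v.
Proof. by congr (- _); apply: eq_bigr => i _; rewrite mulrC. Qed.

Lemma pairingD1 I i v w :
  i \in I -> pairing I v w = pairing (I :\ i) v w - a v i * a w i.
Proof. by move=> iI; rewrite /pairing (big_setD1 i) //= opprD addrC. Qed.

(** The coefficient matrix has more rows than columns, hence a nonzero left kernel vector. *)
Lemma kernel_combination V I : (#|I| < #|V|)%N ->
  exists2 c : T -> rat, exists2 v, v \in V & c v != 0 &
    {in I, forall i, \sum_(v in V) c v * (a v i)%:~R = 0}.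
Proof.
move=> ltIV.
pose M := \matrix_(p < #|V|, q < #|I|) ((a (enum_val p) (enum_val q))%:~R : rat).
have : kermx M != 0.
  rewrite -mxrank_eq0 mxrank_ker subn_eq0 -ltnNge.
  exact: leq_ltn_trans (rank_leq_col M) ltIV.
case/rowV0Pn => r /sub_kermxP rM r0.
have [p rp] : exists p, r 0 p != 0.
  apply/existsP; apply: contraNT r0 => /existsPn H; apply/eqP/rowP=> p.
  by rewrite mxE; apply/eqP; have := H p; rewrite negbK.
pose c v := r 0 (enum_rank_in (enum_valP p) v).
have cE q : c (enum_val q) = r 0 q by rewrite /c enum_valK_in.
exists c; first by exists (enum_val p); rewrite ?enum_valP // cE.
move=> i iI; rewrite big_enum_val /=.
have /matrixP/(_ 0 (enum_rank_in iI i)) := rM.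
rewrite !mxE => rMi; rewrite -[RHS]rMi; apply: eq_bigr => q _.
by rewrite !mxE cE enum_rankK_in.
Qed.

(* Replacing each coefficient of a linear relation by its absolute value can only
   decrease the norm because the off-diagonal pairings are nonnegative, so it yields
   another relation; along an edge leaving its zero set it would fail. *)
Lemma positive_combination V I : config V I ->
  exists2 c : T -> rat, {in V, forall v, 0 < c v} &
    {in I, forall i, \sum_(v in V) c v * (a v i)%:~R = 0}.
Proof.
move=> [cardV aV Q0 Qcut].
have [|c [v0 v0V c0] cI] := @kernel_combination V I; first by rewrite cardV.
have sqr (b : T -> rat) :
  \sum_(i in I) (\sum_(v in V) b v * (a v i)%:~R) ^+ 2 =
  \sum_(v in V) \sum_(w in V) b v * b w * - (pairing I v w)%:~R.
  under eq_bigr => i _ do rewrite expr2 big_distrlr /=.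
  rewrite exchange_big /=; apply: eq_bigr => v _.
  rewrite exchange_big /=; apply: eq_bigr => w _.
  rewrite /pairing -rmorphN opprK rmorph_sum mulr_sumr /=.
  by apply: eq_bigr => i _; rewrite rmorphM /=; ring.
have le0 : \sum_(i in I) (\sum_(v in V) `|c v| * (a v i)%:~R) ^+ 2 <= 0.
  rewrite -[leRHS](_ : \sum_(i in I) (\sum_(v in V) c v * (a v i)%:~R) ^+ 2 = 0).
    2: by apply: big1 => i iI; rewrite cI // expr0n.
  rewrite !sqr; apply: ler_sum => v vV; apply: ler_sum => w wV.
  have [->|vw] := eqVneq v w; first by rewrite -normrM ger0_norm // -expr2 sqr_ge0.
  rewrite ler_wnM2r //; last by rewrite -normrM ler_norm.
  by rewrite oppr_le0 ler0z Q0.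
have rel : {in I, forall i, \sum_(v in V) `|c v| * (a v i)%:~R = 0}.
  move=> i iI; apply/eqP; rewrite -sqrf_eq0; apply/eqP.
  have eq0 : \sum_(i in I) (\sum_(v in V) `|c v| * (a v i)%:~R) ^+ 2 = 0.
    by apply/eqP; rewrite eq_le le0 sumr_ge0 // => k _; apply: sqr_ge0.
  exact: (psumr_eq0P (fun k _ => sqr_ge0 _) eq0 iI).
exists (fun v => `|c v|) => // v vV; rewrite normr_gt0.
apply/negP=> cv0; pose Z := [set z in V | c z == 0].
have [] := Qcut Z.
- by apply/subsetP=> z; rewrite inE => /andP [].
- by apply/set0Pn; exists v; rewrite inE vV.
- by apply: contraNneq c0 => ZV; move: v0V; rewrite -ZV inE => /andP [].
move=> x [y [xZ yVZ Qxy]].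
have [xV /eqP cx] : x \in V /\ c x == 0 by move: xZ; rewrite inE => /andP.
have [yV cy] : y \in V /\ c y != 0.
  by move: yVZ; rewrite !inE; case: (y \in V); rewrite ?andbF //= andbT.
(* The relation is paired with [x], whose own coefficient is 0: nonnegative terms then add up to 0,
   although the term of [y] is positive. *)
have : \sum_(w in V) `|c w| * (pairing I x w)%:~R = 0.
  transitivity (- \sum_(i in I) (a x i)%:~R * \sum_(w in V) `|c w| * (a w i)%:~R).
    under [in RHS]eq_bigr => i _ do rewrite mulr_sumr.
    rewrite exchange_big -sumrN /=; apply: eq_bigr => w _.
    rewrite /pairing rmorphN rmorph_sum mulrN mulr_sumr /=; congr (- _).
    by apply: eq_bigr => i _; rewrite rmorphM /=; ring.
  by rewrite big1 ?oppr0 // => i iI; rewrite rel ?mulr0.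
have ge0 w : w \in V -> 0 <= `|c w| * (pairing I x w)%:~R.
  move=> wV; have [<-|xw] := eqVneq x w; first by rewrite cx normr0 mul0r.
  by rewrite mulr_ge0 // ler0z Q0.
move=> sum0; have /eqP := psumr_eq0P ge0 sum0 yV; rewrite mulf_eq0 normr_eq0 (negPf cy) intr_eq0 /=.
by rewrite gt_eqF.
Qed.

(** Summing the positive relation over [I], that is, pairing it with K, gives a vanishing positive
    combination of these nonpositive numbers. *)
Lemma config_sum_eq0 V I : config V I ->
  {in V, forall v, \sum_(i in I) a v i <= 0} ->
  {in V, forall v, \sum_(i in I) a v i = 0}.
Proof.
move=> /positive_combination [c c0 cI] le0 v vV.
have : \sum_(w in V) c w * - (\sum_(i in I) a w i)%:~R = 0.
  transitivity (- \sum_(i in I) \sum_(w in V) c w * (a w i)%:~R).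
    rewrite exchange_big -sumrN /=; apply: eq_bigr => w _.
    by rewrite rmorph_sum mulrN mulr_sumr.
  by rewrite big1 ?oppr0.
have ge0 w : w \in V -> 0 <= c w * - (\sum_(i in I) a w i)%:~R.
  move=> wV; apply: mulr_ge0; first exact/ltW/c0.
  by rewrite oppr_ge0 lerz0 le0.
move=> sum0; have /eqP := psumr_eq0P ge0 sum0 vV; rewrite mulf_eq0 gt_eqF ?c0 //=.
by rewrite oppr_eq0 intr_eq0 => /eqP.
Qed.

(* The coordinates in [I] of the class of [u] are those of the basis vector [E_i]. *)
Definition exceptional I u i :=
  [/\ i \in I, a u i = 1 & {in I, forall j, j != i -> a u j = 0}].

Lemma pairing_exceptional I u i x : exceptional I u i -> pairing I u x = - a x i.
Proof.
case=> iI ui uj; rewrite /pairing (big_setD1 i) //= ui mul1r big1 ?addr0 //.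
by move=> j; rewrite !inE => /andP [ji jI]; rewrite uj ?mul0r.
Qed.

(** * Contraction of an exceptional class *)

Lemma config_le0 V I u i x : config V I -> exceptional I u i -> u \in V ->
  x \in V -> x != u -> a x i <= 0.
Proof.
move=> [_ _ Q0 _] uE uV xV xu.
by rewrite -oppr_ge0 -(pairing_exceptional x uE) Q0 // eq_sym.
Qed.

(** Dropping [i] adds [a x i * a y i] to the pairing of [x] and [y], a product of nonpositive
    numbers. Pairings therefore only grow, and the neighbours of [u] become mutually adjacent. *)
Lemma config_blowdown V I u i : config V I -> exceptional I u i -> u \in V ->
  config (V :\ u) (I :\ i).
Proof.
move=> cVI uE uV; have le0 := config_le0 cVI uE uV.
case: cVI (uE) => cardV aV Q0 Qcut [iI ui uj].
have mono x y : x \in V :\ u -> y \in V :\ u -> pairing I x y <= pairing (I :\ i) x y.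
  rewrite !inE => /andP [xu xV] /andP [yu yV].
  by rewrite (pairingD1 _ _ iI) gerBl mulr_le0 ?le0.
split.
- by move: cardV; rewrite (cardsD1 u V) uV (cardsD1 i I) iI !add1n => -[].
- move=> v j; rewrite !inE => /andP [ji jI]; rewrite negb_and negbK.
  by case/orP=> [/eqP ->|/aV]; [apply: uj|apply].
- move=> x y xVu yVu xy; apply: le_trans (mono x y xVu yVu).
  by move: xVu yVu; rewrite !inE => /andP [_ xV] /andP [_ yV]; apply: Q0.
move=> S sS Sn0 SnV.
have sSV x : x \in S -> x \in V by move/(subsetP sS); rewrite inE => /andP [].
have uS : u \notin S by apply/negP=> /(subsetP sS); rewrite !inE eqxx.
have keep x y : x \in S -> y \in V :\ u -> y \notin S -> 0 < pairing I x y ->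
    exists x y, [/\ x \in S, y \in V :\ u :\: S & 0 < pairing (I :\ i) x y].
  move=> xS yV yS Qxy; exists x, y; split=> //; first by rewrite inE yS.
  by apply: lt_le_trans Qxy (mono _ _ _ yV); apply: (subsetP sS).
(* If [S] contains all neighbours of [u], an edge leaving [u |: S] cannot start at [u]. *)
have [sN|] := boolP [forall x in V :\ u, (0 < pairing I u x) ==> (x \in S)].
  have [] := Qcut (u |: S).
  - by apply/subsetP=> x; rewrite !inE => /orP [/eqP ->|/sSV].
  - by apply/set0Pn; exists u; rewrite setU11.
  - by apply: contraNneq SnV => <-; rewrite setU1K.
  move=> x [y []]; rewrite !inE => /orP [/eqP ->|xS].
    rewrite negb_or => /andP [/andP [yu yS] yV] Quy.
    by move/forall_inP: sN => /(_ y); rewrite !inE yu yV Quy (negPf yS) => /(_ isT).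
  by rewrite negb_or => /andP [/andP [yu yS] yV]; apply: keep; rewrite // !inE yu.
(* Otherwise [u] has a neighbour [y] outside [S]. If the edge leaving [S] ends at [u], its start and
   [y] both meet [u], so contraction joins them. *)
case/forall_inPn => y yVu; rewrite negb_imply => /andP [Quy yS].
have [] := Qcut S; first by apply/subsetP.
- by [].
- by apply: contraNneq uS => ->.
move=> x [z [xS]]; rewrite inE => /andP [zS zV].
have [->|zu] := eqVneq z u; last by apply: keep; rewrite // !inE zu.
rewrite pairing_sym => Qux; exists x, y; split=> //; first by rewrite inE yS.
have xV := sSV _ xS.
have [yu yV] : y != u /\ y \in V by move: yVu; rewrite !inE => /andP.
have xy : x != y by apply: contraNneq yS => <-.
have := Q0 _ _ xV yV xy; rewrite (pairingD1 _ _ iI) subr_ge0.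
move: Qux Quy; rewrite !(pairing_exceptional _ uE) => xi yi.
apply: lt_le_trans; rewrite -mulrNN mulr_gt0 //.
Qed.

(** * The adjunction formula *)

(** The condition on K with its sign changed, as a sum of nonnegative integers. Coefficients 0 and
    -1 contribute nothing, so dropping them preserves it. *)
Definition adjunction I v := \sum_(i in I) a v i * (a v i + 1) = 2.

Lemma adjunctionD1 I i v : i \in I -> a v i * (a v i + 1) = 0 ->
  adjunction I v -> adjunction (I :\ i) v.
Proof. by move=> iI ai; rewrite /adjunction (big_setD1 i) //= ai add0r. Qed.

(** A positive coefficient must be 1 and exhausts the total 2, so the others are 0 or -1; a positive
    sum then forces them all to be 0. *)
Lemma adjunction_exceptional I v : adjunction I v -> 0 < \sum_(i in I) a v i ->
  exists i, exceptional I v i.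
Proof.
move=> adj pos.
have [i iI ai] : exists2 i, i \in I & 0 < a v i.
  apply/exists_inP; apply: contraTT pos => /exists_inPn H.
  by rewrite -leNgt; apply: sumr_le0 => i /H; rewrite -leNgt.
have tail0 : 0 <= \sum_(j in I :\ i) a v j * (a v j + 1).
  by apply: sumr_ge0 => j _; apply: mul_succ_ge0.
have := adj; rewrite /adjunction (big_setD1 i) //= => adjD.
have ai1 : a v i = 1.
  by move: ai tail0 adjD; move: (a v i) (\sum_(j in _) _) => z s; nia.
have tailE : \sum_(j in I :\ i) a v j * (a v j + 1) = 0.
  by move: adjD; rewrite ai1; move: (\sum_(j in _) _) => s; lia.
have aj j : j \in I :\ i -> a v j <= 0.
  move=> jI; apply: mul_succ_eq0_le0.
  exact: (psumr_eq0P (fun k _ => mul_succ_ge0 (a v k)) tailE jI).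
have tail1 : \sum_(j in I :\ i) - a v j = 0.
  apply/eqP; rewrite eq_le sumrN; apply/andP; split; last first.
    by rewrite oppr_ge0; apply: sumr_le0.
  move: pos; rewrite (big_setD1 i) //= ai1; move: (\sum_(j in _) _) => s; lia.
have zero j : j \in I :\ i -> - a v j = 0.
  by apply: (psumr_eq0P _ tail1) => k /aj; rewrite oppr_ge0.
exists i; split => // j jI ji; apply/eqP; rewrite -oppr_eq0; apply/eqP/zero.
by rewrite !inE ji.
Qed.

(* If no vertex had square -1 then, by adjunction and [config_sum_eq0], all squares
   would be -2, which a coefficient -2 forbids. *)
Lemma config_exceptional V I v0 i0 : config V I -> {in V, forall v, adjunction I v} ->
  v0 \in V -> i0 \in I -> a v0 i0 = -2 ->
  exists u i, u \in V /\ exceptional I u i.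
Proof.
move=> cVI adj v0V i0I av0.
have [/exists_inP [u uV pos]|] := boolP [exists u in V, 0 < \sum_(i in I) a u i].
  by have [i] := adjunction_exceptional (adj u uV) pos; exists u, i.
move/exists_inPn => neg.
have sum0 : \sum_(i in I) a v0 i = 0.
  by apply: (config_sum_eq0 cVI) => // v /neg; rewrite -leNgt.
have := adj v0 v0V; rewrite /adjunction.
under eq_bigr => i _ do rewrite mulrDr mulr1.
rewrite big_split /= sum0 addr0 (big_setD1 i0) //= av0.
have : 0 <= \sum_(j in I :\ i0) a v0 j * a v0 j.
  by apply: sumr_ge0 => j _; rewrite -expr2 sqr_ge0.
by move: (\sum_(j in _) _) => s; lia.
Qed.

(** * Index types as columns of coefficients *)

(** The witness [t] names the vertices carrying the entries of [s], in that order, so that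
    destructuring it yields them. *)
Definition column i (s : seq int) :=
  exists t : seq T, [/\ uniq t, [seq a v i | v <- t] = s &
    forall v, v \notin t -> a v i = 0].

Lemma column_sum i s (F : int -> int) : column i s -> F 0 = 0 ->
  \sum_v F (a v i) = \sum_(z <- s) F z.
Proof.
case=> t [tU <- t0] F0; rewrite big_map (big_uniq _ tU) [RHS]big_mkcond /=.
by apply: eq_bigr => v _; case: ifPn => // /t0 ->.
Qed.

Lemma column_mem i s v : column i s -> a v i \in 0 :: s.
Proof.
case=> t [_ <- t0]; rewrite inE; have [vt|/t0 ->] := boolP (v \in t); last by rewrite eqxx.
by apply/orP; right; apply: map_f.
Qed.

Lemma column_lead i s u : column i (1 :: s) -> 1 \notin s -> a u i = 1 ->
  exists t, [/\ uniq (u :: t), [seq a v i | v <- t] = s &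
    forall v, v != u -> v \notin t -> a v i = 0].
Proof.
case=> [[|h t] [tU //= [ah ts] t0]] s1 au.
have : u \in h :: t by apply/negPn/negP=> /t0; rewrite au.
rewrite inE => /orP [/eqP -> | ut]; last first.
  by move: s1; rewrite -ts -au (map_f (a^~ i) ut).
by exists t; split=> // v vh vt; apply: t0; rewrite inE negb_or vh.
Qed.

(** Types (4), (7) and (9) are the cases [k] = 1, 2, 3: away from [u] the column is minus the
    indicator of [t]. *)
Lemma column_lead_neg i k u : column i (1 :: nseq k (-1)) -> a u i = 1 ->
  exists t, [/\ uniq (u :: t), size t = k &
    forall v, v != u -> a v i = - (v \in t)%:R].
Proof.
move=> col au; have [|t [tU ts t0]] := column_lead col _ au.
  by rewrite mem_nseq andbF.
exists t; split=> // [|v vu]; first by rewrite -(size_map (a^~ i)) ts size_nseq.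
have [vt|vt] := boolP (v \in t); last by rewrite t0 // oppr0.
have : a v i \in nseq k (-1) by rewrite -ts (map_f (a^~ i) vt).
by rewrite mem_nseq => /andP [_ /eqP].
Qed.

Definition typed I i9 i5 :=
  [/\ i9 \in I, i5 \in I, column i9 [:: 1; -1; -1; -1], column i5 [:: 1; -2] &
      {in I, forall j, j != i9 -> j != i5 ->
        column j [:: 1; -1] \/ column j [:: 1; -1; -1]}].

(** The two columns have different sums, -2 and -1. *)
Lemma typed_neq I i9 i5 : typed I i9 i5 -> i5 != i9.
Proof.
case=> _ _ c9 c5 _; apply/eqP=> i59; rewrite i59 in c5.
have := column_sum (F := id) c9 erefl; rewrite (column_sum (F := id) c5 erefl).
by rewrite !big_cons !big_nil.
Qed.

Lemma typedD1 I i9 i5 i : typed I i9 i5 -> i != i9 -> i != i5 -> typed (I :\ i) i9 i5.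
Proof.
case=> h9 h5 c9 c5 ct i9n i5n; split; rewrite // ?inE 1?eq_sym ?i9n ?i5n //.
by move=> j; rewrite inE => /andP [_ jI]; apply: ct.
Qed.

(* Summed over ordered pairs of distinct vertices, an index of type (4) or (7)
   contributes 2, type (9) contributes 0 and type (5) contributes 4, so the total
   weight is that of a tree on [V] and no edge can have weight 2. *)
Lemma pairing_le1 V I i9 i5 : config V I -> typed I i9 i5 ->
  {in V &, forall x y, x != y -> pairing I x y <= 1}.
Proof.
move=> [cardV aV Q0 Qcut] tI x y xV yV xy.
have := cut_connected_weight (pairing_sym I) Q0 Qcut xV yV xy.
suff -> : \sum_(v in V) \sum_(w in V | w != v) pairing I v w = 2 * #|I|%:Z.
  by rewrite cardV; move: (pairing I x y) => z; lia.
have ext (F : int -> int) i : i \in I -> F 0 = 0 ->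
    \sum_(v in V) F (a v i) = \sum_v F (a v i).
  move=> iI F0; rewrite big_mkcond; apply: eq_bigr => v _.
  by case: ifPn => // /(aV _ _ iI) ->.
(* Index by index, the off-diagonal total is the sum of the squares of the column minus the square
   of its sum. *)
transitivity (\sum_(i in I) (\sum_v a v i ^+ 2 - (\sum_v a v i) ^+ 2)).
  transitivity (\sum_(v in V) \sum_(w in V) pairing I v w - \sum_(v in V) pairing I v v).
    rewrite -sumrB; apply: eq_bigr => v vV.
    by rewrite [in RHS](bigD1 v) //= addrAC subrr add0r.
  have -> : \sum_(v in V) pairing I v v = - \sum_(i in I) \sum_v a v i ^+ 2.
    rewrite sumrN exchange_big /=; congr (- _); apply: eq_bigr => i iI.
    by rewrite -(ext (fun z => z ^+ 2)).
  have -> : \sum_(v in V) \sum_(w in V) pairing I v w = - \sum_(i in I) (\sum_v a v i) ^+ 2.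
    under eq_bigr => v _ do rewrite sumrN exchange_big /=.
    rewrite sumrN exchange_big /=; congr (- _); apply: eq_bigr => i iI.
    by rewrite -(ext id) // expr2 big_distrlr.
  by rewrite opprK addrC sumrB.
have i59 := typed_neq tI.
case: tI => h9 h5 c9 c5 ct.
pose g i := \sum_v a v i ^+ 2 - (\sum_v a v i) ^+ 2.
have gE i s : column i s -> g i = \sum_(z <- s) z ^+ 2 - (\sum_(z <- s) z) ^+ 2.
  by move=> c; rewrite /g (column_sum (F := fun z => z ^+ 2) c) ?(column_sum (F := id) c).
rewrite (big_setD1 i9) //= (big_setD1 i5) /=; last by rewrite !inE i59.
rewrite -/(g i9) -/(g i5) (gE _ _ c9) (gE _ _ c5).
have -> : \sum_(i in I :\ i9 :\ i5) (\sum_v a v i ^+ 2 - (\sum_v a v i) ^+ 2) =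
          \sum_(i in I :\ i9 :\ i5) 2.
  apply: eq_bigr => i; rewrite !inE => /andP [i5n /andP [i9n iI]]; rewrite -/(g i).
  by have [c|c] := ct i iI i9n i5n; rewrite (gE _ _ c) !big_cons !big_nil.
rewrite sumr_const (cardsD1 i9 I) h9 (cardsD1 i5 (I :\ i9)) !inE i59 h5 /=.
rewrite !big_cons !big_nil; move: #|_| => m.
by rewrite -mulr_natr; lia.
Qed.

(** * Decorated graphs realizing a configuration *)

(** Injectivity on [V] and the count [dn G = #|V|] make [f] a bijection from [V] onto the numbers
    below [dn G]. *)
Definition realizes V I (G : dgraph) (f : T -> nat) :=
  [/\ dn G = #|V|, {in V &, injective f}, {in V, forall x, (f x < dn G)%N},
      {in V &, forall x y, dadj G (f x) (f y) = (x != y) && (0 < pairing I x y)} &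
      {in V, forall x, ddec G (f x) = pairing I x x}].

Definition extend u (m : nat) (f : T -> nat) x := if x == u then m else f x.

Lemma realizes_eq V I G f x y : realizes V I G f -> x \in V -> y \in V ->
  (f x == f y) = (x == y).
Proof. by move=> [_ finj _ _ _] xV yV; apply: (inj_in_eq finj). Qed.

Lemma realizes_fresh V I G f x : realizes V I G f -> x \in V ->
  (f x == dn G = false) * (dn G == f x = false).
Proof. by move=> [_ _ flt _ _] /flt lt; rewrite ltn_eqF ?gtn_eqF. Qed.

(** * Blow-ups as inverses of contractions *)

Section Blowup.
Variables (V : {set T}) (I : {set J}) (u : T) (i : J) (t : seq T).
Hypotheses (uV : u \in V) (uE : exceptional I u i).
Hypothesis ct : forall v, v != u -> a v i = - (v \in t)%:R.

Lemma pairing_blowup x y : x != u -> y != u ->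
  pairing I x y = pairing (I :\ i) x y - ((x \in t) && (y \in t))%:R.
Proof.
case: uE => iI _ _ xu yu; rewrite (pairingD1 _ _ iI) !ct // mulrNN.
by rewrite -natrM mulnb.
Qed.

Lemma pairing_center x : x != u -> pairing I u x = (x \in t)%:R.
Proof. by move=> xu; rewrite (pairing_exceptional x uE) ct // opprK. Qed.

Lemma pairing_center_self : pairing I u u = -1.
Proof. by rewrite (pairing_exceptional u uE); case: uE => _ ->. Qed.

(** Shared by both kinds of blow-up: the new vertex [dn G] represents [u], and its neighbours are
    the vertices of [t]. *)
Lemma realizes_extend G G' f :
  realizes (V :\ u) (I :\ i) G f -> dn G' = (dn G).+1 ->
  dadj G' (dn G) (dn G) = false ->
  {in V :\ u, forall x, dadj G' (dn G) (f x) = (x \in t)} ->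
  {in V :\ u, forall x, dadj G' (f x) (dn G) = (x \in t)} ->
  {in V :\ u &, forall x y,
     dadj G' (f x) (f y) = (x != y) && (0 < pairing I x y)} ->
  ddec G' (dn G) = -1 ->
  {in V :\ u, forall x, ddec G' (f x) = pairing I x x} ->
  realizes V I G' (extend u (dn G) f).
Proof.
move=> fR dnG' cc cl cr adjG' dc decG'; have [dnG finj flt _ _] := fR.
have inV x : x \in V -> x != u -> x \in V :\ u by move=> xV xu; rewrite !inE xu.
split; rewrite /extend.
- by rewrite dnG' dnG (cardsD1 u V) uV.
- move=> x y xV yV; case: eqVneq => [->|xu]; case: eqVneq => [->|yu] // /eqP.
  + by rewrite (realizes_fresh fR) ?inV.
  + by rewrite (realizes_fresh fR) ?inV.
  by move/eqP; apply: finj; apply: inV.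
- move=> x xV; rewrite dnG'; case: eqVneq => // xu.
  by rewrite ltnW // ltnS flt ?inV.
- move=> x y xV yV.
  case: (eqVneq x u) => [->|xu]; case: (eqVneq y u) => [->|yu].
  + by rewrite cc.
  + by rewrite cl ?inV // pairing_center //; case: (y \in t).
  + by rewrite cr ?inV // pairing_sym pairing_center // xu; case: (x \in t).
  by apply: adjG'; apply: inV.
move=> x xV; case: (eqVneq x u) => [->|xu]; first by rewrite dc pairing_center_self.
by apply: decG'; apply: inV.
Qed.

Lemma realizes_blowup_vertex G f w m :
  Creach G m -> realizes (V :\ u) (I :\ i) G f -> w \in V :\ u ->
  (forall x, (x \in t) = (x == w)) ->
  realizes V I (blowup_vertex G (f w)) (extend u (dn G) f).
Proof.
move=> GR fR wV tE; have [_ _ _ fadj fdec] := fR.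
have fresh x := realizes_fresh fR (x := x).
apply: (realizes_extend fR) => //=.
- by rewrite eqxx !(Creach_fresh _ GR) fresh.
- move=> x xV; rewrite eqxx (Creach_fresh _ GR) !fresh //= tE.
  by rewrite (realizes_eq fR).
- move=> x xV; rewrite eqxx (Creach_fresh _ GR) !fresh //= tE.
  by rewrite (realizes_eq fR) // andbT orbF.
- move=> x y xV yV; rewrite !fresh // !andbF /= orbF fadj //.
  case: (eqVneq x y) => //= xy; move: xV yV; rewrite !inE => /andP [xu _] /andP [yu _].
  rewrite pairing_blowup // !tE.
  have -> : (x == w) && (y == w) = false; last by rewrite subr0.
  by apply: contraNF xy => /andP [/eqP -> /eqP ->].
- by rewrite eqxx.
move=> x xV; rewrite fresh // (realizes_eq fR) // fdec //.
move: xV; rewrite !inE => /andP [xu _]; rewrite pairing_blowup // tE andbb.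
by case: (x == w); rewrite ?subr0.
Qed.

(** Restoring [i] lowers the pairing of [w1] and [w2] from 1 to 0, which is the deletion of their
    edge, and lowers both squares by 1. *)
Lemma realizes_blowup_edge G f w1 w2 m :
  Creach G m -> realizes (V :\ u) (I :\ i) G f -> w1 \in V :\ u -> w2 \in V :\ u ->
  (forall x, (x \in t) = (x == w1) || (x == w2)) ->
  pairing (I :\ i) w1 w2 = 1 ->
  realizes V I (blowup_edge G (f w1) (f w2)) (extend u (dn G) f).
Proof.
move=> GR fR wV1 wV2 tE Q12; have [_ _ _ fadj fdec] := fR.
have fresh x := realizes_fresh fR (x := x).
apply: (realizes_extend fR) => //=.
- by rewrite eqxx !(Creach_fresh _ GR) !fresh.
- move=> x xV; rewrite eqxx (Creach_fresh _ GR) !fresh //= tE.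
  by rewrite !(realizes_eq fR).
- move=> x xV; rewrite eqxx (Creach_fresh _ GR) !fresh //= tE.
  by rewrite !(realizes_eq fR) // !andbT !orbF.
- move=> x y xV yV; rewrite !fresh // !andbF /= !orbF fadj // !(realizes_eq fR) //.
  case: (eqVneq x y) => //= xy; move: xV yV; rewrite !inE => /andP [xu _] /andP [yu _].
  rewrite pairing_blowup // !tE.
  case: (eqVneq x w1) => [x1|_].
    rewrite -x1 (eq_sym y x) (negPf xy) andbF orbF /=.
    case: (eqVneq y w2) => [->|_]; last by rewrite andbT subr0.
    by rewrite x1 Q12 subrr.
  case: (eqVneq x w2) => [x2|_] /=; last by rewrite subr0 andbT.
  rewrite -x2 (eq_sym y x) (negPf xy) orbF.
  case: (eqVneq y w1) => [->|_]; last by rewrite andbT subr0.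
  by rewrite x2 pairing_sym Q12 subrr.
- by rewrite eqxx.
move=> x xV; rewrite fresh // !(realizes_eq fR) // fdec //.
move: xV; rewrite !inE => /andP [xu _]; rewrite pairing_blowup // tE andbb.
by case: (_ || _); rewrite ?subr0.
Qed.

End Blowup.

(** * Contracting down to [Tc] *)

Lemma seq_extract (t : seq T) k v : uniq t -> size t = k.+1 -> v \in t ->
  exists t', [/\ uniq (v :: t'), size t' = k & forall x, (x \in t) = (x == v) || (x \in t')].
Proof.
move=> tU st vt; exists (rem v t); have p := perm_to_rem vt; split.
- by rewrite -(perm_uniq p).
- by rewrite size_rem // st.
by move=> x; rewrite (perm_mem p) inE.
Qed.

Lemma sum_exceptional I u i : exceptional I u i -> \sum_(j in I) a u j = 1.
Proof.
case=> iI ui u0; rewrite (big_setD1 i) //= ui big1 ?addr0 // => j.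
by rewrite !inE => /andP [ji jI]; apply: u0.
Qed.

Lemma column_ex i s z : column i s -> z \in s -> exists v, a v i = z.
Proof. by case=> t [_ <- _] /mapP [v _ ->]; exists v. Qed.

Lemma config_mem V I v i : config V I -> i \in I -> a v i != 0 -> v \in V.
Proof. by move=> [_ aV _ _] iI; apply: contraR => /(aV _ _ iI) ->. Qed.

Lemma adjunction_blowdown I u i (t : seq T) v : exceptional I u i ->
  (forall w, w != u -> a w i = - (w \in t)%:R) -> v != u ->
  adjunction I v -> adjunction (I :\ i) v.
Proof.
case=> iI _ _ ct vu; apply: adjunctionD1 => //.
by rewrite ct //; case: (v \in t); rewrite ?addNr ?mulr0 ?oppr0 ?mul0r.
Qed.

(* [u] meets exactly three vertices [w1], [w2], [w3]; blowing it down makes them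
   pairwise adjacent, which forces blowing down [w1] and then [w3], after which the
   class of [w2] vanishes and connectedness leaves no other vertex. *)
Lemma realizes_Tc V I i9 i5 u : config V I -> {in V, forall v, adjunction I v} ->
  typed I i9 i5 -> u \in V -> exceptional I u i9 ->
  {in V, forall v, v != u -> \sum_(i in I) a v i <= 0} ->
  exists2 f, realizes V I Tc f & f u = 0%N.
Proof.
move=> cV adj tI uV uE neg; have i59 := typed_neq tI.
have [h9 h5 c9 c5 ct] := tI; have [_ u9 u0] := uE.
have [v0 av0] := column_ex (z := -2) c5 isT.
have v0V : v0 \in V by apply: (config_mem cV h5); rewrite av0.
have v0u : v0 != u by apply: contra_eq_neq av0 => ->; rewrite u0.
have [t [tU st t9]] := column_lead_neg (k := 3) c9 u9.
have tV x : x \in t -> x \in V :\ u.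
  move=> xt; have xu : x != u by apply: contraTneq xt => ->; case/andP: tU.
  by rewrite !inE xu; apply: (config_mem cV h9); rewrite t9 // xt.
have cV1 := config_blowdown cV uE uV.
have adj1 : {in V :\ u, forall v, adjunction (I :\ i9) v}.
  move=> v; rewrite !inE => /andP [vu vV].
  by apply: (adjunction_blowdown uE t9) => //; apply: adj.
have [||w1 [j [w1V w1E]]] := config_exceptional cV1 adj1 _ _ av0.
- by rewrite !inE v0u.
- by rewrite !inE i59.
have [w1u w1V'] : w1 != u /\ w1 \in V by move: w1V; rewrite !inE => /andP.
(* A vertex outside [t] keeps its coefficient sum, nonpositive by [neg], and so cannot have become
   exceptional. *)
have w1t : w1 \in t.
  apply: contraT => w1t; have := neg w1 w1V' w1u.
  by rewrite (big_setD1 i9) //= t9 // (negPf w1t) oppr0 add0r (sum_exceptional w1E).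
have [t1 [/= /andP [w1t1 t1U] st1 tE]] := seq_extract (andP tU).2 st w1t.
have t1V x : x \in t1 -> [/\ x \in V :\ u :\ w1, x \in V, x != u & x != w1].
  move=> xt1; have xw1 : x != w1 by apply: contraTneq xt1 => ->.
  have := tV x; rewrite tE xt1 orbT !inE => /(_ isT) /andP [xu xV].
  by rewrite xw1 xu xV.
have [jI w1j w1z] := w1E.
have [ji9 jI'] : j != i9 /\ j \in I by move: jI; rewrite !inE => /andP.
have t1j x : x \in t1 -> a x j <= -1.
  move=> /[dup] xt1 /t1V [_ xV xu xw1].
  have [_ _ Q0 _] := cV; have := Q0 _ _ w1V' xV; rewrite eq_sym xw1 => /(_ isT).
  rewrite (pairing_blowup uE t9) // w1t tE xt1 orbT /= (pairing_exceptional _ w1E).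
  by rewrite subr_ge0 lerNr.
(* Both vertices of [t1] have nonzero coefficients at [j], besides [w1]; types (4) and (5) leave
   room for only one. *)
have cj : column j [:: 1; -1; -1].
  have bound s : column j (1 :: s) -> 1 \notin s -> (2 <= size s)%N.
    move=> c s1; have [t2 [_ <- z2]] := column_lead c s1 w1j.
    rewrite size_map -st1; apply: uniq_leq_size => // x xt1.
    have [_ _ _ xw1] := t1V _ xt1; apply: contraLR (t1j _ xt1) => /(z2 _ xw1) ->.
    by [].
  have [ji5|ji5] := eqVneq j i5.
    by have := bound [:: -2]; rewrite ji5 => /(_ c5 isT).
  by have [c|//] := ct j jI' ji9 ji5; have := bound _ c isT.
have [t2 [/andP [_ t2U] st2 t2j]] := column_lead_neg (k := 2) cj w1j.
have t12 : t1 =i t2.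
  have sub : {subset t1 <= t2}.
    move=> x xt1; have [_ _ _ xw1] := t1V _ xt1.
    by have := t1j _ xt1; rewrite t2j //; case: (x \in t2).
  by have [|_] := uniq_min_size t1U sub; first by rewrite st1 st2.
have aj x : x != w1 -> a x j = - (x \in t1)%:R by move=> /t2j ->; rewrite t12.
have ji5 : j != i5.
  by apply: contraTneq (column_mem v0 cj) => ->; rewrite av0.
have v0w1 : v0 != w1.
  by apply: contra_eq_neq av0 => ->; rewrite w1z // ?inE ?i59 // eq_sym.
have cV2 := config_blowdown cV1 w1E w1V.
have adj2 : {in V :\ u :\ w1, forall v, adjunction (I :\ i9 :\ j) v}.
  move=> v; rewrite in_setD1 => /andP [vw1 vV1].
  by apply: (adjunction_blowdown w1E aj) => //; apply: adj1.
have [||w3 [k [w3V w3E]]] := config_exceptional cV2 adj2 _ _ av0.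
- by rewrite !inE v0u v0w1.
- by rewrite !inE i59 eq_sym ji5.
have [w3w1 w3u w3V'] : [/\ w3 != w1, w3 != u & w3 \in V].
  by move: w3V; rewrite !inE => /and3P.
have sum2 x : x \in V -> x != u -> x \notin t ->
    \sum_(i in I) a x i = \sum_(i in I :\ i9 :\ j) a x i.
  move=> xV xu xt; have [xw1 xt1] : x != w1 /\ x \notin t1.
    by apply/andP; rewrite -negb_or -tE.
  rewrite (big_setD1 i9) //= (big_setD1 j) //= t9 // aj // (negPf xt) (negPf xt1).
  by rewrite oppr0 !add0r.
have w3t1 : w3 \in t1.
  apply: contraT => w3t1; have := neg w3 w3V' w3u.
  by rewrite sum2 ?(sum_exceptional w3E) // tE negb_or w3w1.
have [[|w2 [|? ?]] [w23 //= _ t1E]] := seq_extract t1U st1 w3t1.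
have {}w23 : w2 != w3 by move: w23; rewrite /= inE andbT eq_sym.
have [w2V2 w2V w2u w2w1] : [/\ w2 \in V :\ u :\ w1, w2 \in V, w2 != u & w2 != w1].
  by apply: t1V; rewrite t1E inE eqxx orbT.
have w2t1 : w2 \in t1 by rewrite t1E inE eqxx orbT.
have [kI w3k w3z] := w3E.
have [kj ki9 kI'] : [/\ k != j, k != i9 & k \in I] by move: kI; rewrite !inE => /and3P.
(* Each of the two contractions raised the pairing of [w2] and [w3] by 1. The resulting coefficient,
   at most -2, occurs only in type (5). *)
have w2k : a w2 k <= -2.
  have [_ _ Q0 _] := cV; have := Q0 _ _ w3V' w2V; rewrite eq_sym w23 => /(_ isT).
  rewrite (pairing_blowup uE t9) // (pairing_blowup w1E aj) //.
  rewrite !tE w3t1 w2t1 !orbT /= (pairing_exceptional _ w3E).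
  by rewrite -addrA -opprD subr_ge0 lerNr.
have ki5 : k = i5.
  apply/eqP; apply: contraLR w2k => k5.
  by have [c|c] := ct k kI' ki9 k5; have := column_mem w2 c;
    rewrite !inE; do ?[case/orP => [/eqP -> //|]]; move/eqP ->.
have {ct} [[|w [|? ?]] [//= wU [aw] wz]] := column_lead c5 isT (etrans (congr1 _ (esym ki5)) w3k).
have w2w : w2 = w.
  apply/eqP; rewrite -[_ == _]negbK; apply/negP=> w2w; move: w2k.
  by rewrite ki5 wz // inE.
move: aw wz; rewrite -{w wU}w2w => w25 wz.
have cV3 := config_blowdown cV2 w3E w3V; rewrite ki5 in cV3 kI kj w3E w3k w3z.
have w2V3 : w2 \in V :\ u :\ w1 :\ w3 by rewrite in_setD1 w23.
(* The coefficient -2 alone contributes 2 to adjunction, so every other term of [w2] vanishes. *)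
have w2le i : i \in I :\ i9 :\ j :\ i5 -> a w2 i <= 0.
  have := adj2 _ w2V2; rewrite /adjunction (big_setD1 i5) //= w25 => s2.
  have s0 : \sum_(i in I :\ i9 :\ j :\ i5) a w2 i * (a w2 i + 1) = 0.
    by apply: (addrI (-2 * (-2 + 1))); rewrite s2 addr0.
  move=> iI; apply: mul_succ_eq0_le0.
  exact: (psumr_eq0P (fun k _ => mul_succ_ge0 (a w2 k)) s0 iI).
have le3 : {in V :\ u :\ w1 :\ w3, forall v, \sum_(i in I :\ i9 :\ j :\ i5) a v i <= 0}.
  move=> v vV3; have [->|vw2] := eqVneq v w2; first exact: sumr_le0.
  move: vV3; rewrite !inE => /and4P [vw3 vw1 vu vV].
  have vt : v \notin t by rewrite tE t1E inE !negb_or vw1 vw3.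
  have := neg v vV vu; rewrite sum2 // (big_setD1 i5) //= wz ?add0r //.
  by rewrite inE.
have w20 i : i \in I :\ i9 :\ j :\ i5 -> a w2 i = 0.
  move=> iI; have s0 := config_sum_eq0 cV3 le3 w2V3.
  have s0' : \sum_(i in I :\ i9 :\ j :\ i5) - a w2 i = 0 by rewrite sumrN s0 oppr0.
  apply/eqP; rewrite -oppr_eq0; apply/eqP.
  by apply: (psumr_eq0P _ s0' iI) => l /w2le; rewrite oppr_ge0.
have V3 : V :\ u :\ w1 :\ w3 = [set w2].
  apply/eqP; rewrite eq_sym; apply: contraT => V3.
  have [_ _ _ Qcut] := cV3; have [] := Qcut [set w2] _ _ V3.
  - by rewrite sub1set.
  - by apply/set0Pn; exists w2; rewrite set11.
  move=> x [y [/set1P -> _]]; rewrite /pairing big1 ?oppr0 ?ltxx // => i iI.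
  by rewrite w20 ?mul0r.
have I3 : I :\ i9 :\ j :\ i5 = set0.
  by have [+ _ _ _] := cV3; rewrite V3 cards1 => -[] /esym /eqP; rewrite cards_eq0 => /eqP.
have P x y : pairing I x y = - (a x i9 * a y i9) - a x j * a y j - a x i5 * a y i5.
  rewrite (pairingD1 _ _ h9) (pairingD1 _ _ jI) (pairingD1 _ _ kI) I3.
  by rewrite /pairing big_set0; ring.
have u_j : a u j = 0 by apply: u0.
have u_5 : a u i5 = 0 by apply: u0.
have w1_9 : a w1 i9 = -1 by rewrite t9 // w1t.
have w1_5 : a w1 i5 = 0 by apply: w1z; rewrite ?inE ?i59 // eq_sym.
have w2_9 : a w2 i9 = -1 by rewrite t9 // tE w2t1 orbT.
have w2_j : a w2 j = -1 by rewrite aj // w2t1.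
have w3_9 : a w3 i9 = -1 by rewrite t9 // tE w3t1 orbT.
have w3_j : a w3 j = -1 by rewrite aj // w3t1.
pose val := (u9, u_j, u_5, w1_9, w1j, w1_5, w2_9, w2_j, w25, w3_9, w3_j, w3k).
have Vx x : x \in V -> [\/ x = u, x = w1, x = w2 | x = w3].
  move=> xV; have [->|xu] := eqVneq x u; first exact: Or41.
  have [->|xw1] := eqVneq x w1; first exact: Or42.
  have [->|xw3] := eqVneq x w3; first exact: Or44.
  by apply/Or43/set1P; rewrite -V3 !inE xw3 xw1 xu.
(* In the coordinates [i9], [j], [i5] the rows are (1,0,0), (-1,1,0), (-1,-1,-2), (-1,-1,1), with
   squares -1, -2, -6, -3 in the order of [Tc]. *)
pose l := [:: u; w1; w2; w3].
have lU : uniq l.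
  rewrite /= !inE !negb_or eq_sym w1u eq_sym w2u eq_sym w3u.
  by rewrite eq_sym w2w1 eq_sym w3w1 w23.
have lV x : x \in V -> x \in l.
  by case/Vx=> ->; rewrite !inE eqxx ?orbT.
have fE p : (p < 4)%N -> index (nth u l p) l = p by move=> p4; rewrite index_uniq.
have [fu fw1 fw2 fw3] : [/\ index u l = 0, index w1 l = 1, index w2 l = 2 & index w3 l = 3]%N.
  by split; [apply: (fE 0%N)|apply: (fE 1%N)|apply: (fE 2%N)|apply: (fE 3%N)].
exists (index^~ l) => //; split.
- have [+ _ _ _] := cV; rewrite (cardsD1 i9 I) h9 (cardsD1 j (I :\ i9)) jI.
  by rewrite (cardsD1 i5 (I :\ i9 :\ j)) kI I3 cards0.
- move=> x y /lV xl /lV yl e.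
  by rewrite -(nth_index u xl) e nth_index.
- by move=> x /lV xl; rewrite -[dn Tc]/(size l) index_mem.
- pose neq := (negPf w1u, negPf w2u, negPf w3u, negPf w2w1, negPf w3w1, negPf w23).
  by move=> x y /Vx + /Vx; case=> -> [] ->; rewrite P !val ?fu ?fw1 ?fw2 ?fw3
    ?eqxx ?neq // eq_sym neq.
by move=> x /Vx [] ->; rewrite P !val ?fu ?fw1 ?fw2 ?fw3.
Qed.

(** Induction on the number of vertices. By adjunction a positive coefficient sum means square -1,
    so the last hypothesis is the uniqueness of the (-1)-vertex, an invariant to be restored after
    each contraction. *)
Lemma config_Creach V I i9 i5 : config V I -> {in V, forall v, adjunction I v} ->
  typed I i9 i5 ->
  {in V &, forall v w, 0 < \sum_(i in I) a v i -> 0 < \sum_(i in I) a w i -> v = w} ->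
  exists G f u, [/\ Creach G (f u), realizes V I G f, u \in V & 0 < \sum_(i in I) a u i].
Proof.
have [m] := ubnP #|V|; elim: m => // m IHm in V I * => Vm cV adj tI one.
have [h9 h5 c9 c5 ct] := tI.
have [v0 av0] := column_ex (z := -2) c5 isT.
have v0V : v0 \in V by apply: (config_mem cV h5); rewrite av0.
have [u [i [uV uE]]] := config_exceptional cV adj v0V h5 av0.
have [iI ui u0] := uE.
have upos : 0 < \sum_(j in I) a u j by rewrite (sum_exceptional uE).
have neg : {in V, forall v, v != u -> \sum_(j in I) a v j <= 0}.
  move=> v vV; apply: contraNT; rewrite -ltNge => vpos; apply/eqP; exact: one.
have [i9E|i9n] := eqVneq i i9.
  rewrite i9E in uE; have [f fV fu] := realizes_Tc cV adj tI uV uE neg.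
  by exists Tc, f, u; rewrite fu; split=> //; apply: Creach_Tc.
have [i5E|i5n] := eqVneq i i5.
  rewrite i5E in uE ui; have uv0 : u != v0 by apply: contra_eq_neq av0 => <-; rewrite ui.
  by have := pairing_le1 cV tI uV v0V uv0; rewrite (pairing_exceptional _ uE) av0.
have cV1 := config_blowdown cV uE uV.
have tI1 := typedD1 tI i9n i5n.
have V1m : (#|V :\ u| < m)%N by move: Vm; rewrite (cardsD1 u V) uV.
(* Common to types (4) and (7): only vertices of [t] can gain a positive sum, so uniqueness needs
   checking inside [t] alone. *)
have step (t : seq T) (ta : forall v, v != u -> a v i = - (v \in t)%:R) :
    (forall v w j k, v \in t -> w \in t ->
      exceptional (I :\ i) v j -> exceptional (I :\ i) w k -> v = w) ->
    exists G f w, [/\ Creach G (f w), realizes (V :\ u) (I :\ i) G f, w \in V :\ u,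
      w \in t & ddec G (f w) = -1].
  have pos_t v : v \in V :\ u -> 0 < \sum_(j in I :\ i) a v j -> v \in t.
    rewrite !inE => /andP [vu vV] vpos; apply: contraT => vt.
    have := neg v vV vu; rewrite (big_setD1 i) //= ta // (negPf vt) oppr0 add0r.
    by rewrite leNgt vpos.
  have adj1 : {in V :\ u, forall v, adjunction (I :\ i) v}.
    move=> v; rewrite !inE => /andP [vu vV].
    by apply: (adjunction_blowdown uE ta) => //; apply: adj.
  have sum_pos v : v \in V :\ u -> 0 < \sum_(j in I :\ i) a v j ->
      exists j, exceptional (I :\ i) v j.
    by move=> /adj1; apply: adjunction_exceptional.
  move=> one_t.
  have one1 : {in V :\ u &, forall v w, 0 < \sum_(j in I :\ i) a v j ->
      0 < \sum_(j in I :\ i) a w j -> v = w}.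
    move=> v w vV1 wV1 vpos wpos; have [j vE] := sum_pos v vV1 vpos.
    have [k wE] := sum_pos w wV1 wpos.
    by apply: (one_t v w j k) => //; apply: pos_t.
  have [G [f [w [GR fR wV1 wpos]]]] := IHm _ _ V1m cV1 adj1 tI1 one1.
  exists G, f, w; split=> //; first exact: pos_t.
  have [_ _ _ _ ->] := fR; rewrite //.
  by have [p wE] := sum_pos _ wV1 wpos; rewrite (pairing_exceptional w wE); case: wE => _ ->.
have tV (t : seq T) x : (forall v, v != u -> a v i = - (v \in t)%:R) -> uniq (u :: t) ->
    x \in t -> x \in V :\ u.
  move=> ta /andP [ut _] xt; have xu : x != u by apply: contraTneq xt => ->.
  by rewrite !inE xu; apply: (config_mem cV iI); rewrite ta // xt oppr_eq0.
have [c|c] := ct i iI i9n i5n.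
  have [[|w [|? ?]] [// tU _ ta]] := column_lead_neg (k := 1) c ui.
  have [x y j k|G [f [w' [GR fR w'V w't dw']]]] := step _ ta.
    by rewrite !inE => /eqP -> /eqP ->.
  move: w't; rewrite inE => /eqP w'E; rewrite {w'}w'E in GR w'V dw'.
  exists (blowup_vertex G (f w)), (extend u (dn G) f), u; split=> //.
    by rewrite /extend eqxx; apply: Creach_vertex.
  apply: (realizes_blowup_vertex uV uE ta GR fR w'V) => x.
  by rewrite inE.
have [t [tU st ta]] := column_lead_neg (k := 2) c ui.
have gt0 x y : x \in t -> y \in t -> x != y -> 0 < pairing (I :\ i) x y.
  move=> xt yt xy; have [_ _ Q0 _] := cV.
  have := tV _ _ ta tU xt; have := tV _ _ ta tU yt.
  rewrite !inE => /andP [yu yV] /andP [xu xV].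
  have := Q0 _ _ xV yV xy; rewrite (pairing_blowup uE ta) // xt yt /=.
  by rewrite subr_ge0 -gtz0_ge1.
(* Distinct vertices of [t] meet after the contraction, whereas two exceptional classes pair to 0 or
   -1. *)
have [x y p q xt yt pE [qI yq y0]|G [f [w [GR fR wV wt dw]]]] := step _ ta.
  apply/eqP; apply: contraT => xy; have := gt0 x y xt yt xy.
  rewrite (pairing_exceptional _ pE) oppr_gt0 ltNge; case: pE => pI _ _.
  by have [->|pq] := eqVneq p q; rewrite ?yq ?y0.
have [[|w' [|? ?]] [w'U //= _ tE]] := seq_extract (andP tU).2 st wt.
have ww' : w != w' by move: w'U; rewrite /= inE andbT.
have w't : w' \in t by rewrite tE inE eqxx orbT.
have w'V := tV _ _ ta tU w't.
have Q1 : pairing (I :\ i) w w' = 1.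
  apply/eqP; rewrite eq_le (pairing_le1 cV1 tI1) //= -gtz0_ge1; exact: gt0.
exists (blowup_edge G (f w) (f w')), (extend u (dn G) f), u; split=> //.
  rewrite /extend eqxx; have [dnG _ flt fadj _] := fR.
  by apply: Creach_edge => //; [apply: flt|rewrite fadj // ww' Q1].
apply: (realizes_blowup_edge uV uE ta GR fR wV w'V) => // x.
by rewrite tE inE.
Qed.
End Configuration.

(** * From the embedding to a configuration *)

Lemma perm_map_column (T J : finType) (a : T -> J -> int) i (s : seq int) (t : seq T) :
  uniq t -> (forall v, v \notin t -> a v i = 0) ->
  perm_eq [seq a v i | v <- t] s -> column a i s.
Proof.
move=> tU t0; rewrite perm_sym => /(perm_iotaP 0) [p]; rewrite size_map => pt ->.
case: t => [|v0 t] in tU t0 pt *.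
  by exists [::]; split=> //; case: p pt => // x p /perm_size.
have pt' : perm_eq [seq nth v0 (v0 :: t) k | k <- p] (v0 :: t).
  by rewrite -[X in perm_eq _ X](mkseq_nth v0); apply: perm_map.
exists [seq nth v0 (v0 :: t) k | k <- p]; split.
- by rewrite (perm_uniq pt').
- rewrite -map_comp; apply/eq_in_map => k; rewrite (perm_mem pt) mem_iota => kt.
  by rewrite (nth_map v0 0 (a^~ i)).
by move=> v; rewrite (perm_mem pt'); apply: t0.
Qed.

Lemma index_type_column n (phi : 'I_n -> 'I_n -> int) i k s :
  type_multiset k = Some s -> index_type phi i k -> column phi i s.
Proof.
rewrite /index_type => ->; apply: perm_map_column.
  by rewrite filter_uniq ?enum_uniq.
by move=> v; rewrite mem_filter mem_enum andbT negbK => /eqP.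
Qed.

Theorem theorem3p13 (n : nat) (adj : rel 'I_n) (d : 'I_n -> int)
  (phi : 'I_n -> 'I_n -> int) :
  in_S adj d ->
  is_embedding adj d phi ->
  #|[set i : 'I_n | index_type phi i 9]| = 1%N ->
  #|[set i : 'I_n | index_type phi i 5]| = 1%N ->
  #|[set i : 'I_n | index_type phi i 2]| = 1%N ->
  (forall i : 'I_n, [|| index_type phi i 9, index_type phi i 5, index_type phi i 2,
                       index_type phi i 4 | index_type phi i 7]) ->
  in_C adj d.
Proof.
move=> [[n0 _ adjirr adjconn _] dmin _ _] [Qadj Qd QK] card9 card5 card2 types.
have single k : #|[set i : 'I_n | index_type phi i k]| = 1%N ->
    exists i0, forall i, index_type phi i k = (i == i0).
  by move/eqP/cards1P => [i0 E]; exists i0 => i; rewrite -in_set1 -E inE.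
have [i9 i9P] := single _ card9; have [i5 i5P] := single _ card5.
have [e eP] := single _ card2.
have type_col i k s := @index_type_column n phi i k s.
have c9 : column phi i9 [:: 1; -1; -1; -1] by apply: (type_col _ 9%N); rewrite ?i9P.
have c5 : column phi i5 [:: 1; -2] by apply: (type_col _ 5%N); rewrite ?i5P.
have c2 : column phi e [:: -1] by apply: (type_col _ 2%N); rewrite ?eP.
have [u0 [u0e ue]] : exists u0, phi u0 e = -1 /\ forall v, v != u0 -> phi v e = 0.
  have [[|u0 [|? ?]] [_ //= [u0e] z]] := c2; exists u0; split=> // v vu.
  by apply: z; rewrite inE.
pose I := [set~ e].
(* The column of type (2) is recognized by its sum of squares, 1. *)
have neq_e i s : column phi i s -> \sum_(z <- s) z ^+ 2 != 1 -> i != e.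
  move=> c; apply: contraNneq => ie; rewrite ie in c.
  rewrite -(column_sum (F := fun z => z ^+ 2) c) //.
  by rewrite (column_sum (F := fun z => z ^+ 2) c2) // big_seq1.
have i9e : i9 != e by apply: neq_e c9 _; rewrite !big_cons big_nil.
have i5e : i5 != e by apply: neq_e c5 _; rewrite !big_cons big_nil.
have sumE (F : 'I_n -> int) : \sum_(i < n) F i = F e + \sum_(i in I) F i.
  by rewrite (bigD1 e) //=; congr (_ + _); apply: eq_bigl => i; rewrite !inE.
have tI : typed phi I i9 i5.
  split=> //; rewrite ?inE // => j; rewrite !inE => je j9 j5.
  have := types j; rewrite i9P i5P eP (negPf je) (negPf j9) (negPf j5) /=.
  by case/orP=> [/(type_col _ 4%N _ erefl)|/(type_col _ 7%N _ erefl)] c; [left|right].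
(* Only [u0] has a nonzero coefficient at [e], so deleting [e] changes no pairing except the square
   of [u0], which rises by 1. *)
have QI v w : pairing phi I v w = Qn (phi v) (phi w) + phi v e * phi w e.
  by rewrite /Qn sumE opprD addrAC addNr add0r.
have QIadj v w : v != w -> pairing phi I v w = if adj v w then 1 else 0.
  move=> vw; rewrite QI Qadj //; have [vu|vu] := eqVneq v u0.
    by rewrite (ue w) ?mulr0 ?addr0 // -vu eq_sym.
  by rewrite (ue v) // mul0r addr0.
have adjn v w : adj v w -> v != w by apply: contraTneq => ->.
have cV : config phi setT I.
  split=> [|v i _|v w _ _ vw|].
  - by rewrite cardsT card_ord /I cardsC1 card_ord prednK.
  - by rewrite inE.
  - by rewrite QIadj //; case: ifP.
  apply: (connect_cut_connected (e := adj)) => // x y xy.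
  by rewrite QIadj ?xy // adjn.
have adjI v : adjunction phi I v.
  have e0 : phi v e * (phi v e + 1) = 0.
    by have := column_mem v c2; rewrite !inE => /orP [] /eqP ->.
  transitivity (\sum_(i < n) phi v i * (phi v i + 1)); first by rewrite sumE e0 add0r.
  apply: oppr_inj; rewrite -(QK v) /Qn -opprD -big_split /=; congr (- _).
  by apply: eq_bigr => i _; rewrite mulrDr addrC.
have pos_self v : 0 < \sum_(i in I) phi v i -> pairing phi I v v = -1.
  move/(adjunction_exceptional (adjI v)) => [i vE].
  by rewrite (pairing_exceptional v vE); case: vE => _ ->.
(* For any other vertex the square -1 would be its decoration, against minimality. *)
have pos_u0 v : 0 < \sum_(i in I) phi v i -> v = u0.
  move/pos_self; rewrite QI Qd => dv; apply/eqP; apply: contraT => vu.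
  by have := dmin v; rewrite -dv (ue v) // mul0r addr0 eqxx.
have [||G [f [u [GR fR _ upos]]]] := config_Creach cV _ tI.
- by move=> v _; apply: adjI.
- by move=> v w _ _ /pos_u0 -> /pos_u0 ->.
have [dnG finj flt fadj fdec] := fR.
have dnn : dn G = n by rewrite dnG cardsT card_ord.
have fn x : (f x < n)%N by rewrite -dnn flt ?inE.
exists G, (f u); split=> //; split=> //; exists (fun x => Ordinal (fn x)); split.
- by move=> x y [] /finj; apply; rewrite inE.
- move=> x y /=; rewrite fadj ?inE //; have [->|xy] := eqVneq x y.
    by apply/negbTE.
  by rewrite QIadj //=; case: (adj x y).
move=> x /=; rewrite (realizes_eq fR) ?inE //; have uu0 := pos_u0 u upos.
(* Restoring [e] lowers the square of [u0] from -1 to -2, the final change of decoration. *)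
have [->|xu] := eqVneq x u.
  by have := pos_self u upos; rewrite QI Qd uu0 u0e => /(canRL (addrK _)) ->.
by rewrite fdec ?inE // QI Qd (ue x) ?mul0r ?addr0 // -uu0.
Qed.
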